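(* For every integer $n\geq 2$, $$\mathrm{R}_{3,2}(P_3,P_n,P_n)=\mathrm{R}_{3,2}(K_3,P_n,P_n)=n.$$
   Context: $P_n$ denotes the path on $n$ vertices and $K_3$ the triangle. For positive integers $r\ge s$ and graphs $G_1,\dots,G_r$, the set-coloring Ramsey number $\mathrm{R}_{r,s}(G_1,\dots,G_r)$ is the least $N\in\mathbb{N}$ such that for every coloring $\chi:E(K_N)\to\binom{[r]}{s}$ (each edge receives a set of $s$ distinct colors from $[r]=\{1,\dots,r\}$) there exist $i\in[r]$ and a copy of $G_i$ in $K_N$ such that $i\in\chi(e)$ for every edge $e$ of this copy. *)

(* Defs.v *)
From mathcomp Require Import all_boot.

Set Implicit Arguments.
Unset Strict Implicit.
Unset Printing Implicit Defensive.

Record sgraph := SGraph {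
  vertex :> finType;
  adj : rel vertex;
  adj_sym : symmetric adj;
  adj_irrefl : irreflexive adj
}.

Definition edges (G : sgraph) : {set {set G}} :=
  [set [set p.1; p.2] | p : G * G & adj p.1 p.2].

Definition complete_rel (n : nat) : rel 'I_n := fun i j => i != j.

Lemma complete_sym n : symmetric (@complete_rel n).
Proof. by move=> i j; rewrite /complete_rel eq_sym. Qed.

Lemma complete_irrefl n : irreflexive (@complete_rel n).
Proof. by move=> i; rewrite /complete_rel eqxx. Qed.

Definition complete_graph (n : nat) : sgraph :=
  SGraph (@complete_sym n) (@complete_irrefl n).

Definition path_rel (n : nat) : rel 'I_n :=
  fun i j => (i.+1 == j :> nat) || (j.+1 == i :> nat).

Lemma path_sym n : symmetric (@path_rel n).
Proof. by move=> i j; rewrite /path_rel orbC. Qed.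

Lemma path_irrefl n : irreflexive (@path_rel n).
Proof. by move=> i; rewrite /path_rel orbb gtn_eqF. Qed.

(* The path on [n] vertices (not [n] edges). *)
Definition path_graph (n : nat) : sgraph :=
  SGraph (@path_sym n) (@path_irrefl n).

(* A (not necessarily induced) copy of [H] in [G] is given by an injective
   graph homomorphism [f]; the edges of the copy are the images [f @: e]. *)
Definition is_copy (H G : sgraph) (f : H -> G) : Prop :=
  injective f /\ forall e, e \in edges H -> f @: e \in edges G.

(* Only the values of [chi] on [edges (complete_graph N)] matter; the palette
   [r] = {1, ..., r} is represented by ['I_r]. *)
Definition set_coloring (r s N : nat)
    (chi : {set complete_graph N} -> {set 'I_r}) : Prop :=
  forall e, e \in edges (complete_graph N) -> #|chi e| = s.

Definition set_coloring_arrow (r s : nat) (Gs : 'I_r -> sgraph) (N : nat)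
    : Prop :=
  forall chi : {set complete_graph N} -> {set 'I_r}, set_coloring s chi ->
    exists (i : 'I_r) (f : Gs i -> complete_graph N),
      is_copy f /\ forall e, e \in edges (Gs i) -> i \in chi (f @: e).

(* A function is used because [sgraph] is too large, universe-wise, for [seq]
   and [tuple]. *)
Definition graphs3 (G1 G2 G3 : sgraph) (i : 'I_3) : sgraph :=
  match val i with 0 => G1 | 1 => G2 | _ => G3 end.

(* [N] is the set-coloring Ramsey number R_{r,s}(G_1, ..., G_r). *)
Definition is_set_coloring_ramsey (r s : nat) (Gs : 'I_r -> sgraph) (N : nat)
    : Prop :=
  set_coloring_arrow s Gs N /\
  forall M, set_coloring_arrow s Gs M -> N <= M.

Lemma is_set_coloring_ramsey_unique r s (Gs : 'I_r -> sgraph) N N' :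
  is_set_coloring_ramsey s Gs N -> is_set_coloring_ramsey s Gs N' -> N = N'.
Proof.
by move=> [aN mN] [aN' mN']; apply/eqP; rewrite eqn_leq mN ?mN'.
Qed.

(* Main.v *)
Require Import Defs.
From mathcomp Require Import all_boot.

(** For the upper bound, let [e] be the graph of the edges that miss the first
    color; its edges carry both other colors.  If the first color spans no
    triangle then [e] has no independent set of size three, and then [e] either
    has a Hamiltonian path or is covered by two disjoint nonempty cliques.  In
    the latter case any edge between the cliques carries the second or the third
    color, and in that color it joins the two cliques into a Hamiltonian path.
    For the lower bound, color all edges of a smaller complete graph with the
    second and third colors. *)

Section IndependenceTwo.

Variables (T : eqType) (e : rel T).
Hypothesis e_sym : symmetric e.

Definition clique (s : seq T) : Prop :=
  {in s &, forall x y, x != y -> e x y}.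

Definition hamiltonian (r : rel T) (s : seq T) : Prop :=
  exists2 p, perm_eq p s & sorted r p.

Lemma hamiltonian_perm r s t : perm_eq s t -> hamiltonian r s -> hamiltonian r t.
Proof. by move=> st [p ps rp]; exists p => //; apply: perm_trans st. Qed.

Lemma clique_sub s t : {subset s <= t} -> clique t -> clique s.
Proof. by move=> st ct x y /st xt /st yt; apply: ct. Qed.

Lemma clique_cons u s : clique s -> all (e u) s -> clique (u :: s).
Proof.
move=> cs /allP us x y; rewrite !inE => /orP[/eqP->|xs] /orP[/eqP->|ys].
- by rewrite eqxx.
- by move=> _; apply: us.
- by move=> _; rewrite e_sym; apply: us.
- exact: cs.
Qed.

Lemma clique_sorted s : uniq s -> clique s -> sorted e s.
Proof.
elim: s => [//|x [//|y s] IHs] /andP[xs us] cs /=.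
apply/andP; split.
  apply: cs; rewrite ?inE ?eqxx ?orbT //.
  by move: xs; rewrite inE negb_or => /andP[].
by apply: IHs => //; apply: clique_sub cs => z zs; rewrite inE zs orbT.
Qed.

(** Every ordering of a clique is a path, so [p] can be listed with [a] last and [q] with [b] first;
    the pair [a], [b] then links the two lists. *)
Lemma cliques_joined (r : rel T) p q a b :
    subrel e r -> r a b -> a \in p -> b \in q -> uniq p -> uniq q ->
  clique p -> clique q -> hamiltonian r (p ++ q).
Proof.
move=> er rab ap bq up uq cp cq.
pose p' := rcons (rem a p) a; pose q' := b :: rem b q.
have pp' : perm_eq p' p by rewrite perm_rcons perm_sym perm_to_rem.
have qq' : perm_eq q' q by rewrite perm_sym perm_to_rem.
exists (p' ++ q'); first exact: perm_cat.
have sp' : sorted r p'.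
  apply: sub_sorted er _ _; apply: clique_sorted; first by rewrite (perm_uniq pp').
  by apply: clique_sub cp => z; rewrite (perm_mem pp').
have sq' : sorted r q'.
  apply: sub_sorted er _ _; apply: clique_sorted; first by rewrite (perm_uniq qq').
  by apply: clique_sub cq => z; rewrite (perm_mem qq').
rewrite /p' in sp' *; case: (rem a p) sp' => [_|x s] /=.
  by rewrite rab.
by move=> sp'; rewrite cat_path sp' last_rcons /= rab.
Qed.

(** The elements [a] and [b] witness that both cliques are nonempty; they need not be adjacent. *)
Definition two_cliques (s : seq T) : Prop :=
  exists p q a b, [/\ perm_eq (p ++ q) s, a \in p, b \in q, clique p & clique q].

Hypothesis no_independent3 : forall x y z,
  x != y -> y != z -> x != z -> [|| e x y, e y z | e x z].

(** If [u] has no neighbor on the path, any two other vertices are adjacent, since otherwise they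
    would be independent together with [u]. If [u] has a neighbor, it is attached at an end of the
    path, possibly after a rotation. *)
Lemma hamiltonian_add u s : uniq (u :: s) -> hamiltonian e s ->
  hamiltonian e (u :: s) \/ two_cliques (u :: s).
Proof.
move=> uus [p ps ep].
have {uus} /andP[up pU] : uniq (u :: p).
  by rewrite (perm_uniq (s2 := u :: s)) // perm_cons.
suff [h|[p' [q [a [b [h1 h2 h3 h4 h5]]]]]] :
    hamiltonian e (u :: p) \/ two_cliques (u :: p).
- by left; apply: hamiltonian_perm h; rewrite perm_cons.
- right; exists p', q, a, b; split=> //.
  by apply: perm_trans h1 _; rewrite perm_cons.
have neq_u x : x \in p -> u != x by move=> xp; apply: contraNneq up => ->.
have [/hasP[v vp uv]|/hasPn Nu] := boolP (has (e u) p); last first.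
  (* An empty path would leave the second clique empty, but then [u] alone is a Hamiltonian path. *)
  case: p up pU neq_u Nu {ps ep} => [|x p] up pU neq_u Nu.
    by left; exists [:: u].
  right; exists [:: u], (x :: p), u, x; split; rewrite ?mem_head //.
    by move=> y z; rewrite !inE => /eqP-> /eqP->; rewrite eqxx.
  move=> y z yp zp yz; move: (no_independent3 _ _ _ (neq_u y yp) yz (neq_u z zp)).
  by rewrite (negbTE (Nu y yp)) (negbTE (Nu z zp)) orbF.
left; case/splitPr: vp ep {ps} up pU neq_u => p1 p2 ep up pU neq_u.
have [ep1 ep2] : sorted e p1 /\ path e v p2.
  case: (p1) ep => [//|x p3] /=; rewrite cat_path /= => /andP[-> /andP[_ ->]] //.
case: p1 ep1 ep up pU neq_u => [|x p1] ep1 ep up pU neq_u.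
  by exists [:: u, v & p2]; rewrite //= uv.
have [ux|Nux] := boolP (e u x).
  exists (u :: (x :: p1) ++ v :: p2) => //.
  by rewrite /= ux; exact: ep.
set z := last v p2.
have zin : z \in v :: p2 by apply: mem_last.
have zp : z \in (x :: p1) ++ v :: p2 by rewrite mem_cat zin orbT.
have [uz|Nuz] := boolP (e u z).
  exists (((x :: p1) ++ v :: p2) ++ [:: u]); first by rewrite perm_catC.
  by rewrite /= cat_path (ep : path e x (p1 ++ v :: p2)) /= last_cat /= -/z e_sym uz.
have xz : x != z.
  move: pU; rewrite /= mem_cat negb_or -andbA => /and3P[_ + _].
  by apply: contraNneq => ->.
have xp : x \in (x :: p1) ++ v :: p2 by rewrite mem_head.
have := no_independent3 _ _ _ (neq_u x xp) xz (neq_u z zp).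
rewrite (negbTE Nux) (negbTE Nuz) orbF /= => exz.
(* The edge between the ends [x] and [z] closes the path into a cycle; cut just before [v], it
   becomes a path starting at a neighbor of [u]. *)
exists (u :: (v :: p2) ++ (x :: p1)); first by rewrite perm_cons perm_catC.
by rewrite /= uv cat_path ep2 /= -/z e_sym exz.
Qed.

(** Induction on [s]. In the case of two cliques, either [u] is adjacent to all of one and enlarges
    it, or [u] misses some [x] in one and some [y] in the other. Then [x] and [y] are adjacent, the
    cliques join into a Hamiltonian path of [s], and [hamiltonian_add] applies. *)
Lemma hamiltonian_or_two_cliques s :
  uniq s -> hamiltonian e s \/ two_cliques s.
Proof.
elim: s => [_|u s IHs uus]; first by left; exists [::].
have /andP[us sU] := uus.
have [/(hamiltonian_add _ _ uus)//|[p [q [a [b [pqs ap bq cp cq]]]]]] := IHs sU.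
have [/clique_cons up|/allPn[x xp Nux]] := boolP (all (e u) p).
  right; exists (u :: p), q, a, b; split=> //; first by rewrite perm_cons.
    by rewrite inE ap orbT.
  exact: up.
have [/clique_cons uq|/allPn[y yq Nuy]] := boolP (all (e u) q).
  right; exists p, (u :: q), a, b; split=> //.
  - by rewrite -cat1s perm_catCA perm_cons.
  - by rewrite inE bq orbT.
  - exact: uq.
have pqU : uniq (p ++ q) by rewrite (perm_uniq pqs).
have neq_u z : z \in p ++ q -> u != z.
  by rewrite (perm_mem pqs) => zs; apply: contraNneq us => ->.
move: (pqU); rewrite cat_uniq => /and3P[pU /hasPn pq qU].
have xy : x != y by apply: contraTneq xp => ->; apply: pq.
have exy : e x y.
  have ux : u != x by apply: neq_u; rewrite mem_cat xp.
  have uy : u != y by apply: neq_u; rewrite mem_cat yq orbT.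
  by have := no_independent3 _ _ _ ux xy uy; rewrite (negbTE Nux) (negbTE Nuy) orbF.
apply: hamiltonian_add => //; apply: hamiltonian_perm pqs _.
exact: (cliques_joined _ _ _ x y).
Qed.

End IndependenceTwo.

Lemma mem_edges (G : sgraph) (x y : G) : adj x y -> [set x; y] \in edges G.
Proof. by move=> xy; apply/imsetP; exists (x, y) => //; rewrite inE. Qed.

Lemma monochromatic_copy (H : sgraph) r N
    (chi : {set complete_graph N} -> {set 'I_r}) c (f : H -> complete_graph N) :
    injective f -> (forall x y, adj x y -> c \in chi [set f x; f y]) ->
  is_copy f /\ forall e, e \in edges H -> c \in chi (f @: e).
Proof.
move=> f_inj cf; have imf x y : f @: [set x; y] = [set f x; f y].
  by rewrite imsetU !imset_set1.
split; [split=> // e | move=> e].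
  case/imsetP=> -[x y]; rewrite inE /= => xy ->; rewrite imf.
  apply: (mem_edges (complete_graph N)).
  rewrite /= /complete_rel (inj_eq f_inj); apply: contraTneq xy => ->.
  by rewrite adj_irrefl.
by case/imsetP=> -[x y]; rewrite inE /= => xy ->; rewrite imf cf.
Qed.

Lemma monochromatic_path r N (chi : {set complete_graph N} -> {set 'I_r}) c :
    hamiltonian _ (fun x y => c \in chi [set x; y]) (enum (complete_graph N)) ->
  exists f : path_graph N -> complete_graph N,
    is_copy f /\ forall e, e \in edges (path_graph N) -> c \in chi (f @: e).
Proof.
case=> p p_enum p_path.
have pU : uniq p by rewrite (perm_uniq p_enum) enum_uniq.
have sz_p : size p = N by rewrite (perm_size p_enum) -cardE card_ord.
(* The index [i] doubles as the default vertex, which is never returned because [p] has size [N]. *)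
exists (fun i : 'I_N => nth i p i); apply: monochromatic_copy.
  move=> i j; rewrite (set_nth_default i j) ?sz_p // => /eqP.
  by rewrite nth_uniq ?sz_p // => /eqP/val_inj.
have step (i j : 'I_N) : i.+1 = j -> c \in chi [set nth i p i; nth j p j].
  move=> ij; rewrite (set_nth_default i j) ?sz_p // -ij.
  by move/(sortedP i): p_path => /(_ i); apply; rewrite sz_p ij.
by move=> i j /orP[/eqP/step//|/eqP/step]; rewrite setUC.
Qed.

Lemma arrow_triangle_path n :
  set_coloring_arrow 2
    (graphs3 (complete_graph 3) (path_graph n) (path_graph n)) n.
Proof.
move=> chi chi2.
pose V : finType := complete_graph n.
pose c0 : 'I_3 := @Ordinal 3 0 isT; pose c1 : 'I_3 := @Ordinal 3 1 isT.
pose c2 : 'I_3 := @Ordinal 3 2 isT.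
pose r c : rel V := fun x y => c \in chi [set x; y].
pose e : rel V := fun x y => (x != y) && ~~ r c0 x y.
have r_sym c : symmetric (r c) by move=> x y; rewrite /r setUC.
have e_sym : symmetric e by move=> x y; rewrite /e eq_sym r_sym.
have chi_ne (x y : V) (c : 'I_3) : x != y -> ~ (chi [set x; y] \subset [set c]).
  by move=> xy /subset_leq_card; rewrite cards1 (chi2 _ (mem_edges (complete_graph n) _ _ xy)).
have e_r c : c != c0 -> subrel e (r c).
  (* Without [c0] and [c], only the third color [d] would be left for an edge that has two
     colors. *)
  move=> cc0 x y /andP[xy N0]; apply: contraT => Nc.
  have [d dP] : exists d, forall i : 'I_3, [|| i == c0, i == c | i == d].
    case: c cc0 {Nc} => [[|[|[|//]]] c3] // _; [exists c2 | exists c1];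
      by case=> [[|[|[|]]] i3].
  case: (chi_ne x y d xy); apply/subsetP=> i ri; rewrite inE.
  have /or3P[/eqP i0|/eqP ic|//] := dP i; first by rewrite -i0 /r ri in N0.
  by rewrite -ic /r ri in Nc.
have r12 (x y : V) : x != y -> r c1 x y || r c2 x y.
  move=> xy; apply: contraT; rewrite negb_or => /andP[N1 N2].
  case: (chi_ne x y c0 xy); apply/subsetP=> -[[|[|[|//]]] i3] ri; rewrite inE //.
    by case/negP: N1; rewrite /r (_ : c1 = Ordinal i3) //; apply: val_inj.
  by case/negP: N2; rewrite /r (_ : c2 = Ordinal i3) //; apply: val_inj.
have [/existsP[x /existsP[y /existsP[z]]]|noT] := boolP [exists x : V, exists y : V,
    exists z : V, [&& x != y, y != z, x != z, r c0 x y, r c0 y z & r c0 x z]].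
  case/and5P=> xy yz xz rxy /andP[ryz rxz]; exists c0.
  exists (fun i : 'I_3 => nth x [:: x; y; z] i).
  apply: monochromatic_copy => [i j /eqP|].
    rewrite nth_uniq ?ltn_ord //= ?inE ?negb_or ?xy ?xz ?yz //.
    by move/eqP/val_inj.
  case=> [[|[|[|//]]] i3] [[|[|[|//]]] j3] //= _;
    by rewrite ?[_ \in _]rxy ?[_ \in _]ryz ?[_ \in _]rxz // setUC.
(* Three vertices independent in [e] would form a triangle in color [c0], which [noT] excludes. *)
have ind3 x y z : x != y -> y != z -> x != z -> [|| e x y, e y z | e x z].
  move=> xy yz xz; apply: contraR noT; rewrite /e xy yz xz !negb_or !negbK.
  case/and3P=> rxy ryz rxz.
  apply/existsP; exists x; apply/existsP; exists y; apply/existsP; exists z.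
  by rewrite xy yz xz rxy ryz rxz.
suff [ham|ham] : hamiltonian V (r c1) (enum V) \/ hamiltonian V (r c2) (enum V).
- by exists c1; apply: monochromatic_path.
- by exists c2; apply: monochromatic_path.
have [[p p_enum ep]|[p [q [a [b [pq ap bq cp cq]]]]]] :=
    hamiltonian_or_two_cliques _ _ e_sym ind3 _ (enum_uniq V).
  by left; exists p => //; apply: sub_sorted ep; apply: e_r.
have : uniq (p ++ q) by rewrite (perm_uniq pq) enum_uniq.
rewrite cat_uniq => /and3P[pU /hasPn pq0 qU].
(* The edge from [a] to [b] may lie outside [e], but it has [c1] or [c2]; the edges inside the
   cliques have both, so either color works. *)
have /r12/orP[rab|rab] : a != b by apply: contraTneq ap => ->; apply: pq0.
  left; apply: hamiltonian_perm pq _.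
  by apply: (cliques_joined _ e _ _ _ a b) => //; apply: e_r.
right; apply: hamiltonian_perm pq _.
by apply: (cliques_joined _ e _ _ _ a b) => //; apply: e_r.
Qed.

(** The path on three vertices is a subgraph of the triangle on the same vertex type ['I_3], so the
    embedding of a triangle serves unchanged. *)
Lemma arrow_path3_path n :
  set_coloring_arrow 2 (graphs3 (path_graph 3) (path_graph n) (path_graph n)) n.
Proof.
have sub (e : {set 'I_3}) : e \in edges (path_graph 3) -> e \in edges (complete_graph 3).
  case/imsetP=> -[x y]; rewrite inE /= => xy ->.
  apply: (@mem_edges (complete_graph 3)).
  by apply: contraTneq xy => ->; rewrite path_irrefl.
move=> chi /arrow_triangle_path[[[|[|[|//]]] i3] [f [[f_inj fE] fc]]].
- exists (Ordinal i3), f; split; first by split=> // e /sub/fE.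
  by move=> e /sub/fc.
- by exists (Ordinal i3), f.
- by exists (Ordinal i3), f.
Qed.

(** Under the constant coloring by the last two colors no edge has the first color, so the edge of
    [G] rules out a copy of [G]; a copy of the path needs [n] vertices. *)
Lemma arrow_lower_bound (G : sgraph) (x y : G) n M : adj x y ->
  set_coloring_arrow 2 (graphs3 G (path_graph n) (path_graph n)) M -> n <= M.
Proof.
move=> xy arrow.
have /arrow : set_coloring 2 (fun _ : {set complete_graph M} => [set~ (ord0 : 'I_3)]).
  by move=> e _; rewrite cardsC1 card_ord.
have path_le (f : path_graph n -> complete_graph M) : injective f -> n <= M.
  by move/leq_card; rewrite !card_ord.
case=> [[[|[|[|//]]] i3] [f [[f_inj _] fc]]].
- by have := fc _ (mem_edges _ _ _ xy); rewrite !inE.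
- exact: path_le f_inj.
- exact: path_le f_inj.
Qed.

Theorem theorem2p3 (n : nat) (hn : 2 <= n) :
  is_set_coloring_ramsey 2
    (graphs3 (path_graph 3) (path_graph n) (path_graph n)) n /\
  is_set_coloring_ramsey 2
    (graphs3 (complete_graph 3) (path_graph n) (path_graph n)) n.
Proof.
(* These vertices are adjacent both in the path and in the triangle. *)
pose i0 : 'I_3 := @Ordinal 3 0 isT; pose i1 : 'I_3 := @Ordinal 3 1 isT.
split; split.
- exact: arrow_path3_path.
- by move=> M; apply: (arrow_lower_bound (path_graph 3) i0 i1).
- exact: arrow_triangle_path.
- by move=> M; apply: (arrow_lower_bound (complete_graph 3) i0 i1).
Qed.
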